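(* The functors $\mathrm{Spec}: \mathbf{tHA} \leftrightarrows \mathbf{tES} : \mathrm{Clop}$ are pseudo-inverse, implying that $\mathbf{tHA} \simeq \mathbf{tES}^{\mathrm{op}}$.
   Context: Write $\mathsf{P}$ for the ''past diamond'' operator (the black diamond, left adjoint of $\Box$). A temporal Heyting algebra is an algebra $(A,\wedge,\vee,\to,\mathsf{P},\Box,0,1)$ such that $(A,\wedge,\vee,\to,0,1)$ is a Heyting algebra, $\Box(a\wedge b)=\Box a\wedge\Box b$, $a\le\Box a$, $\Box a\le b\vee(b\to a)$, and $\mathsf{P}a\le b \iff a\le\Box b$ for all $a,b$. $\mathbf{tHA}$ is the category of temporal Heyting algebras with algebraic homomorphisms. A temporal Esakia space is $(X,R^{\lhd},R^{\rhd},\le,\Omega)$ where $(X,\le,\Omega)$ is an Esakia space, $\le$ is the reflexive closure of $R^{\rhd}$ (i.e. $x\le y$ iff $xR^{\rhd}y$ or $x=y$), $R^{\lhd}$ is the inverse of $R^{\rhd}$, and for every clopen upset $K$ and point $x$: $\{x : R^{\rhd}[x]\subseteq K\}$ is a clopen upset, $R^{\rhd}[K]$ is a clopen upset, and $R^{\rhd}[x]$ and $R^{\lhd}[x]$ are closed. A temporal Esakia morphism is an Esakia morphism $f$ such that: $x_1R^{\rhd}x_2 \Rightarrow fx_1R^{\rhd}fx_2$; $fx_1R^{\rhd}y \Rightarrow \exists x_3\,(x_1R^{\rhd}x_3$ and $fx_3=y)$; $x_3R^{\lhd}x_2\Rightarrow fx_3R^{\lhd}fx_2$; $fx_2R^{\lhd}y\Rightarrow\exists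 x_1\,(x_2R^{\lhd}x_1$ and $y\le fx_1)$. $\mathbf{tES}$ is the resulting category. $\mathrm{Spec}(A)$ is the set of prime filters of $A$ ordered by inclusion, with topology generated by the sets $\pi a=\{x : a\in x\}$ and their complements, and with $xR^{\rhd}y$ iff $\forall a\,(\Box a\in x\Rightarrow a\in y)$ and $xR^{\lhd}w$ iff $\forall a\,(a\in w\Rightarrow \mathsf{P}a\in x)$; on morphisms $\mathrm{Spec}(h)=h^{-1}[\cdot]$. $\mathrm{Clop}(X)$ is the algebra of clopen upsets of $X$ with $\cap,\cup$, $K_1\to K_2 = X\setminus{\downarrow}(K_1\setminus K_2)$, $\Box K=\{x: R^{\rhd}[x]\subseteq K\}$, $\mathsf{P}K=R^{\rhd}[K]$; on morphisms $\mathrm{Clop}(f)=f^{-1}[\cdot]$. *)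

(* Defs.v *)
From HB Require Import structures.
From mathcomp Require Import all_boot all_order finmap.
From mathcomp Require Import all_classical.
From mathcomp Require Import topology_structure compact order_topology.

Set Implicit Arguments.
Unset Strict Implicit.
Unset Printing Implicit Defensive.

Import Order.Theory.

Local Open Scope classical_set_scope.
Local Open Scope order_scope.

Record category := Category {
  obj :> Type;
  hom : obj -> obj -> Type;
  idm : forall A, hom A A;
  compm : forall A B C, hom B C -> hom A B -> hom A C;
  compm_idl : forall A B (f : hom A B), compm (idm B) f = f;
  compm_idr : forall A B (f : hom A B), compm f (idm A) = f;
  compmA : forall A B C D (f : hom C D) (g : hom B C) (h : hom A B),
    compm f (compm g h) = compm (compm f g) h
}.
Arguments hom {c}.
Arguments idm {c}.
Arguments compm {c A B C}.

Definition op (C : category) : category :=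
  @Category (obj C) (fun A B => @hom C B A) (@idm C)
    (fun A B D f g => compm g f)
    (fun A B f => compm_idr f) (fun A B f => compm_idl f)
    (fun A B D E f g h => esym (compmA h g f)).

Definition is_iso (C : category) (A B : C) (f : hom A B) : Prop :=
  exists g : hom B A, compm g f = idm A /\ compm f g = idm B.

Record functor (C D : category) := Functor {
  fobj :> C -> D;
  fmor : forall A B : C, hom A B -> hom (fobj A) (fobj B);
  fmor_id : forall A : C, fmor (idm A) = idm (fobj A);
  fmor_comp : forall (A B E : C) (g : hom B E) (f : hom A B),
    fmor (compm g f) = compm (fmor g) (fmor f)
}.
Arguments fmor {C D} _ {A B} _.

Definition idF (C : category) : functor C C :=
  @Functor C C id (fun _ _ f => f) (fun _ => erefl) (fun _ _ _ _ _ => erefl).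

Definition compF (C D E : category) (G : functor D E) (F : functor C D) :
    functor C E :=
  @Functor C E (fun A => G (F A)) (fun _ _ f => fmor G (fmor F f))
    (fun A => etrans (congr1 (fmor G) (fmor_id F A)) (fmor_id G (F A)))
    (fun A B H g f =>
       etrans (congr1 (fmor G) (fmor_comp F g f)) (fmor_comp G _ _)).

Definition naturally_isomorphic (C D : category) (F G : functor C D) : Prop :=
  exists eta : forall A : C, hom (F A) (G A),
    (forall (A B : C) (f : hom A B),
       compm (fmor G f) (eta A) = compm (eta B) (fmor F f)) /\
    (forall A : C, is_iso (eta A)).

Definition pseudo_inverse (C D : category) (F : functor C D) (G : functor D C) :
    Prop :=
  naturally_isomorphic (idF C) (compF G F) /\
  naturally_isomorphic (idF D) (compF F G).

Definition equivalent_categories (C D : category) : Prop :=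
  exists (F : functor C D) (G : functor D C), pseudo_inverse F G.

HB.mixin Record isHeyting d (T : Type) of Order.TBLattice d T := {
  himp : T -> T -> T;
  le_himp : forall a b c : T, (a `&` b <= c) = (a <= himp b c)
}.

#[short(type="heytingType")]
HB.structure Definition Heyting d := {T of isHeyting d T & Order.TBLattice d T}.

HB.mixin Record isTemporalHeyting d (T : Type) of Heyting d T := {
  box : T -> T;
  past : T -> T;
  boxI : forall a b : T, box (a `&` b) = box a `&` box b;
  le_box : forall a : T, a <= box a;
  box_le_himp : forall a b : T, box a <= b `|` himp b a;
  past_box : forall a b : T, (past a <= b) = (a <= box b)
}.

#[short(type="temporalHeytingType")]
HB.structure Definition TemporalHeyting d :=
  {T of isTemporalHeyting d T & Heyting d T}.

Record is_tha_morphism d d' (A : temporalHeytingType d)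
    (B : temporalHeytingType d') (f : A -> B) : Prop := ThaMorphism {
  tham_meet : forall a b, f (a `&` b) = f a `&` f b;
  tham_join : forall a b, f (a `|` b) = f a `|` f b;
  tham_himp : forall a b, f (himp a b) = himp (f a) (f b);
  tham_past : forall a, f (past a) = past (f a);
  tham_box : forall a, f (box a) = box (f a);
  tham_bot : f \bot = \bot;
  tham_top : f \top = \top
}.

Record tha_hom d d' (A : temporalHeytingType d) (B : temporalHeytingType d') :=
  ThaHom { tha_fun :> A -> B; tha_funP : is_tha_morphism tha_fun }.

Definition upset d (T : POrderedTopological.type d) (U : set T) : Prop :=
  forall x y : T, U x -> x <= y -> U y.

Definition downset_of d (T : POrderedTopological.type d) (U : set T) : set T :=
  [set x | exists2 y, U y & x <= y].

HB.mixin Record isEsakia d (T : Type) of POrderedTopological d T := {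
  esakia_compact : compact [set: T];
  priestley_separation : forall x y : T, ~~ (x <= y) ->
    exists U : set T, [/\ clopen U, upset U, U x & ~ U y];
  clopen_downset_of : forall U : set T, clopen U -> clopen (downset_of U)
}.

#[short(type="esakiaType")]
HB.structure Definition Esakia d :=
  {T of isEsakia d T & POrderedTopological d T}.

(* [Rfut x] and [Rpast x] are the sets of R^{\rhd}- and R^{\lhd}-successors of
   x, so [Rfut x y] reads x R^{\rhd} y. *)
HB.mixin Record isTemporalEsakia d (T : Type) of Esakia d T := {
  Rfut : T -> set T;
  Rpast : T -> set T;
  le_Rfut : forall x y : T, x <= y <-> Rfut x y \/ x = y;
  Rpast_inv : forall x y : T, Rpast x y <-> Rfut y x;
  clopen_upset_box : forall K : set T, clopen K -> upset K ->
    clopen [set x | Rfut x `<=` K] /\ upset [set x | Rfut x `<=` K];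
  clopen_upset_past : forall K : set T, clopen K -> upset K ->
    clopen (\bigcup_(x in K) Rfut x) /\ upset (\bigcup_(x in K) Rfut x);
  closed_Rfut : forall x : T, closed (Rfut x);
  closed_Rpast : forall x : T, closed (Rpast x)
}.

#[short(type="temporalEsakiaType")]
HB.structure Definition TemporalEsakia d :=
  {T of isTemporalEsakia d T & Esakia d T}.

Record is_esakia_morphism d d' (X : esakiaType d) (Y : esakiaType d')
    (f : X -> Y) : Prop := EsakiaMorphism {
  esm_continuous : continuous f;
  esm_le : forall x y, x <= y -> f x <= f y;
  esm_back : forall x y, f x <= y -> exists2 z, x <= z & f z = y
}.

Record is_tes_morphism d d' (X : temporalEsakiaType d)
    (Y : temporalEsakiaType d') (f : X -> Y) : Prop := TesMorphism {
  tesm_esakia : is_esakia_morphism f;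
  tesm_fut : forall x1 x2, Rfut x1 x2 -> Rfut (f x1) (f x2);
  tesm_fut_back : forall x1 y, Rfut (f x1) y ->
    exists2 x3, Rfut x1 x3 & f x3 = y;
  tesm_past : forall x3 x2, Rpast x3 x2 -> Rpast (f x3) (f x2);
  tesm_past_back : forall x2 y, Rpast (f x2) y ->
    exists2 x1, Rpast x2 x1 & y <= f x1
}.

Record tes_hom d d' (X : temporalEsakiaType d) (Y : temporalEsakiaType d') :=
  TesHom { tes_fun :> X -> Y; tes_funP : is_tes_morphism tes_fun }.

Lemma tha_hom_eq d d' (A : temporalHeytingType d) (B : temporalHeytingType d')
  (f g : tha_hom A B) : f =1 g -> f = g.
Proof.
case: f g => [f fP] [g gP] /= /funext fg; subst g.
by congr ThaHom; exact: Prop_irrelevance.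
Qed.

Lemma tes_hom_eq d d' (X : temporalEsakiaType d) (Y : temporalEsakiaType d')
  (f g : tes_hom X Y) : f =1 g -> f = g.
Proof.
case: f g => [f fP] [g gP] /= /funext fg; subst g.
by congr TesHom; exact: Prop_irrelevance.
Qed.

Lemma tha_id_subproof d (A : temporalHeytingType d) :
  is_tha_morphism (@id A).
Proof. by split. Qed.

Definition tha_id d (A : temporalHeytingType d) : tha_hom A A :=
  ThaHom (tha_id_subproof A).

Lemma tha_comp_subproof d1 d2 d3 (A : temporalHeytingType d1)
    (B : temporalHeytingType d2) (C : temporalHeytingType d3)
    (g : tha_hom B C) (f : tha_hom A B) :
  is_tha_morphism (g \o f).
Proof.
case: f g => [f [f1 f2 f3 f4 f5 f6 f7]] [g [g1 g2 g3 g4 g5 g6 g7]].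
by split=> /= *; rewrite ?(f1, f2, f3, f4, f5, f6, f7).
Qed.

Definition tha_comp d1 d2 d3 (A : temporalHeytingType d1)
    (B : temporalHeytingType d2) (C : temporalHeytingType d3)
    (g : tha_hom B C) (f : tha_hom A B) : tha_hom A C :=
  ThaHom (tha_comp_subproof g f).

Lemma tes_id_subproof d (X : temporalEsakiaType d) :
  is_tes_morphism (@id X).
Proof.
split=> // [|x y xy|x y xy]; last by exists y.
- by split=> // [x U|x y xy]; [|exists y].
- by exists y.
Qed.

Definition tes_id d (X : temporalEsakiaType d) : tes_hom X X :=
  TesHom (tes_id_subproof X).

Lemma tes_comp_subproof d1 d2 d3 (X : temporalEsakiaType d1)
    (Y : temporalEsakiaType d2) (Z : temporalEsakiaType d3)
    (g : tes_hom Y Z) (f : tes_hom X Y) :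
  is_tes_morphism (g \o f).
Proof.
case: f g => [f [[fc fl fb] f1 f2 f3 f4]] [g [[gc gl gb] g1 g2 g3 g4]].
split=> [|x y|x y|x y|x y] /=.
- split=> [x|x y|x y] /=.
  + by apply: continuous_comp; [exact: fc|exact: gc].
  + by move=> /fl/gl.
  + by move=> /gb[z /fb[w xw <-] <-]; exists w.
- by move=> /f1/g1.
- by move=> /g2[z /f2[w xw <-] <-]; exists w.
- by move=> /f3/g3.
- move=> /g4[z /f4[w xw zw] yz]; exists w => //.
  exact: le_trans yz (gl _ _ zw).
Qed.

Definition tes_comp d1 d2 d3 (X : temporalEsakiaType d1)
    (Y : temporalEsakiaType d2) (Z : temporalEsakiaType d3)
    (g : tes_hom Y Z) (f : tes_hom X Y) : tes_hom X Z :=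
  TesHom (tes_comp_subproof g f).

(* Displays only steer notations and carry no mathematical content; all objects
   of the two categories share this one. *)
Definition cat_display : Order.disp_t := Order.Disp tt tt.

Definition tHA : category.
Proof.
refine (@Category (temporalHeytingType cat_display) (fun A B => tha_hom A B)
  (fun A => tha_id A) (fun A B C g f => tha_comp g f) _ _ _);
  by move=> *; exact: tha_hom_eq.
Defined.

Definition tES : category.
Proof.
refine (@Category (temporalEsakiaType cat_display) (fun X Y => tes_hom X Y)
  (fun X => tes_id X) (fun X Y Z g f => tes_comp g f) _ _ _);
  by move=> *; exact: tes_hom_eq.
Defined.

Record clop d (X : temporalEsakiaType d) := ClopenUpset {
  clop_set :> set X;
  clop_clopen : clopen clop_set;
  clop_upset : upset clop_set
}.

HB.instance Definition _ d (X : temporalEsakiaType d) := gen_eqMixin (clop X).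
HB.instance Definition _ d (X : temporalEsakiaType d) :=
  gen_choiceMixin (clop X).

Section ClopAlgebra.
Context d (X : temporalEsakiaType d).
Implicit Types K L M : clop X.

Lemma clop_eq K L : (K : set X) = L -> K = L.
Proof.
case: K L => [K Kc Ku] [L Lc Lu] /= KL; subst L.
by congr ClopenUpset; exact: Prop_irrelevance.
Qed.

Definition clop_le K L : bool := `[< (K : set X) `<=` L >].

Lemma clop_le_refl : reflexive clop_le.
Proof. by move=> K; apply/asboolP. Qed.

Lemma clop_le_anti : antisymmetric clop_le.
Proof.
move=> K L /andP[/asboolP KL /asboolP LK]; apply: clop_eq.
by apply/seteqP; split.
Qed.

Lemma clop_le_trans : transitive clop_le.
Proof.
by move=> L K M /asboolP KL /asboolP LM; apply/asboolP; exact: subset_trans LM.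
Qed.

HB.instance Definition _ := Order.Le_isPOrder.Build cat_display (clop X)
  clop_le_refl clop_le_anti clop_le_trans.

Lemma clop_leP K L : reflect ((K : set X) `<=` L) (K <= L).
Proof. exact: asboolP. Qed.

Lemma upset_setI (U V : set X) : upset U -> upset V -> upset (U `&` V)%classic.
Proof.
by move=> Uu Vu x y [Ux Vx] xy; split; [exact: Uu xy|exact: Vu xy].
Qed.

Lemma upset_setU (U V : set X) : upset U -> upset V -> upset (U `|` V)%classic.
Proof.
by move=> Uu Vu x y [Ux|Vx] xy; [left; exact: Uu xy|right; exact: Vu xy].
Qed.

Definition clop_meet K L : clop X :=
  ClopenUpset (clopenI (clop_clopen K) (clop_clopen L))
              (upset_setI (@clop_upset _ _ K) (@clop_upset _ _ L)).

Definition clop_join K L : clop X :=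
  ClopenUpset (clopenU (clop_clopen K) (clop_clopen L))
              (upset_setU (@clop_upset _ _ K) (@clop_upset _ _ L)).

Lemma clop_meetP K L M : (K <= clop_meet L M) = (K <= L) && (K <= M).
Proof.
apply/clop_leP/andP => [KLM|[/clop_leP KL /clop_leP KM] x Kx].
  by split; apply/clop_leP => x /KLM[].
by split; [exact: KL|exact: KM].
Qed.

Lemma clop_joinP K L M : (clop_join K L <= M) = (K <= M) && (L <= M).
Proof.
apply/clop_leP/andP => [KLM|[/clop_leP KM /clop_leP LM] x [/KM|/LM]//].
by split; apply/clop_leP => x Kx; apply: KLM; [left|right].
Qed.

HB.instance Definition _ := Order.POrder_MeetJoin_isLattice.Build cat_display
  (clop X) clop_meetP clop_joinP.

Definition clop_bot : clop X :=
  @ClopenUpset _ X set0 clopen0 (fun x y (h : set0 x) _ => h).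

Definition clop_top : clop X :=
  @ClopenUpset _ X setT clopenT (fun _ _ _ _ => I).

Lemma clop_le0 K : clop_bot <= K.
Proof. by apply/clop_leP => x []. Qed.

Lemma clop_le1 K : K <= clop_top.
Proof. by apply/clop_leP. Qed.

HB.instance Definition _ :=
  Order.hasBottom.Build cat_display (clop X) clop_le0.
HB.instance Definition _ := Order.hasTop.Build cat_display (clop X) clop_le1.

Lemma clop_imp_clopen K L :
  clopen (~` downset_of ((K : set X) `\` L))%classic.
Proof.
have dc : clopen (downset_of ((K : set X) `\` L))%classic.
  apply: clopen_downset_of; rewrite setDE; apply: clopenI.
    exact: clop_clopen.
  by apply: (clopenC set0); exact: clop_clopen.
exact: (clopenC set0).
Qed.

Lemma clop_imp_upset K L :
  upset (~` downset_of ((K : set X) `\` L))%classic.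
Proof.
move=> x y nx xy [z KLz yz]; apply: nx; exists z => //.
exact: le_trans yz.
Qed.

Definition clop_imp K L : clop X :=
  ClopenUpset (clop_imp_clopen K L) (@clop_imp_upset K L).

Lemma clop_impP K L M : (K `&` L <= M) = (K <= clop_imp L M).
Proof.
apply/clop_leP/clop_leP => [KLM x Kx [y [Ly nMy] xy]|KLM x [Kx Lx]].
  by apply/nMy/KLM; split=> //; exact: clop_upset xy.
by apply: contrapT => nMx; apply: (KLM x Kx); exists x.
Qed.

HB.instance Definition _ := isHeyting.Build cat_display (clop X) clop_impP.

Lemma clop_box_subproof K : clopen [set x | Rfut x `<=` K] /\ upset [set x | Rfut x `<=` K].
Proof.
by apply: clopen_upset_box; [exact: clop_clopen|exact: clop_upset].
Qed.

Definition clop_box K : clop X :=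
  ClopenUpset (proj1 (clop_box_subproof K)) (proj2 (clop_box_subproof K)).

Lemma clop_past_subproof K : clopen (\bigcup_(x in K) Rfut x) /\ upset (\bigcup_(x in K) Rfut x).
Proof.
by apply: clopen_upset_past; [exact: clop_clopen|exact: clop_upset].
Qed.

Definition clop_past K : clop X :=
  ClopenUpset (proj1 (clop_past_subproof K)) (proj2 (clop_past_subproof K)).

Lemma clop_boxI K L : clop_box (K `&` L) = clop_box K `&` clop_box L.
Proof.
apply: clop_eq; apply/seteqP; split=> [x KL|x [xK xL] y xy].
  by split=> y /KL[].
by split; [exact: xK|exact: xL].
Qed.

Lemma clop_le_box K : K <= clop_box K.
Proof.
apply/clop_leP => x Kx y xy; apply: clop_upset Kx _.
by apply/le_Rfut; left.
Qed.

Lemma clop_box_le_himp K L : clop_box K <= L `|` himp L K.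
Proof.
apply/clop_leP => x xK; have [Lx|nLx] := pselect ((L : set X) x); [by left|right].
move=> [y [Ly nKy] /le_Rfut[/xK//|xy]].
by apply: nLx; rewrite xy.
Qed.

Lemma clop_past_box K L : (clop_past K <= L) = (K <= clop_box L).
Proof.
apply/clop_leP/clop_leP => [KL x Kx y xy|KL y [x Kx xy]].
  by apply: KL; exists x.
exact: KL Kx _ xy.
Qed.

HB.instance Definition _ := isTemporalHeyting.Build cat_display (clop X)
  clop_boxI clop_le_box clop_box_le_himp clop_past_box.

End ClopAlgebra.

Section ClopMorphism.
Context d d' (X : temporalEsakiaType d) (Y : temporalEsakiaType d').
Context (f : tes_hom X Y).

Lemma clop_preimage_clopen (K : clop Y) : clopen (f @^-1` K).
Proof.
apply: preimage_clopen; first exact: clop_clopen.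
exact: esm_continuous (tesm_esakia (tes_funP f)).
Qed.

Lemma clop_preimage_upset (K : clop Y) : upset (f @^-1` K).
Proof.
move=> x y Kx xy; apply: clop_upset Kx _.
exact: esm_le (tesm_esakia (tes_funP f)) _ _ xy.
Qed.

Definition clop_preimage (K : clop Y) : clop X :=
  ClopenUpset (clop_preimage_clopen K) (@clop_preimage_upset K).

Lemma clop_preimage_morphism : is_tha_morphism clop_preimage.
Proof.
have [[fc fl fb] f1 f2 f3 f4] := tes_funP f.
split=> [K L|K L|K L|K|K||]; apply: clop_eq => //; apply/seteqP; split=> x /=.
- by move=> nx [y [Ky nLy] xy]; apply: nx; exists (f y); [|exact: fl].
- move=> nx [z [Kz nLz] /fb[y xy yz]]; apply: nx; exists y => //.
  by rewrite /= /preimage /= yz.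
- move=> [y Ky /Rpast_inv/f4[x1 /Rpast_inv xx1 yx1]]; exists x1 => //.
  exact: clop_upset yx1.
- by move=> [y Ky yx]; exists (f y) => //; exact: f1.
- by move=> xK y xy; apply: xK; exact: f1.
- by move=> xK z /f2[y xy <-]; exact: xK.
Qed.

Definition clop_hom : tha_hom (clop Y) (clop X) :=
  ThaHom clop_preimage_morphism.

End ClopMorphism.

Definition Clop : functor (op tES) tHA.
Proof.
refine (@Functor (op tES) tHA
  (fun X : tES => (clop X : temporalHeytingType cat_display))
  (fun (X Y : tES) (f : tes_hom Y X) => clop_hom f) _ _);
  by move=> *; apply: tha_hom_eq => K; exact: clop_eq.
Defined.

Record is_filter d (A : heytingType d) (x : set A) : Prop := IsFilter {
  filter_top : x \top;
  filter_le : forall a b, x a -> a <= b -> x b;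
  filter_meet : forall a b, x a -> x b -> x (a `&` b)
}.

Record is_ideal d (A : heytingType d) (x : set A) : Prop := IsIdeal {
  ideal_bot : x \bot;
  ideal_le : forall a b, x b -> a <= b -> x a;
  ideal_join : forall a b, x a -> x b -> x (a `|` b)
}.

Record is_prime_filter d (A : heytingType d) (x : set A) : Prop :=
IsPrimeFilter {
  prime_filter : is_filter x;
  prime_proper : ~ x \bot;
  prime_join : forall a b, x (a `|` b) -> x a \/ x b
}.

Section PrimeFilterTheorem.
Context d (A : heytingType d).
Implicit Types (F I : set A) (a b c : A).

Lemma heyting_leIU a b c : a `&` (b `|` c) <= (a `&` b) `|` (a `&` c).
Proof.
rewrite meetC le_himp leUx -!le_himp.
by rewrite ![_ `&` a]meetC leUl leUr.
Qed.

Lemma is_filter_adjoin F a : is_filter F ->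
  is_filter [set b | exists2 c, F c & c `&` a <= b].
Proof.
case=> F1 Fle FI; split=> [|b b' [c Fc cb] bb'|b b' [c Fc cb] [c' Fc' cb']].
- by exists \top => //; exact: lex1.
- by exists c => //; exact: le_trans bb'.
- exists (c `&` c'); first exact: FI.
  rewrite lexI; apply/andP; split.
    by apply: le_trans cb; rewrite leI2// leIl.
  by apply: le_trans cb'; rewrite leI2// leIr.
Qed.

Lemma prime_filter_theorem F I : is_filter F -> is_ideal I ->
  (forall a, F a -> ~ I a) ->
  exists x : set A, [/\ is_prime_filter x, F `<=` x & forall a, x a -> ~ I a].
Proof.
move=> Ff Ii FI.
pose P X := is_filter (F `|` X)%classic /\ forall a, X a -> ~ I a.
have [] := @Zorn_bigcup _ P.
  move=> C CP Ctot; split; last by move=> a [X /CP[_]]; exact.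
  have dir X Y : C X -> C Y -> exists2 Z, C Z & X `<=` Z /\ Y `<=` Z.
    move=> CX CY; have [XY|YX] := Ctot X Y CX CY.
      by exists Y => //; split.
    by exists X => //; split.
  case: (Ff) => F1 Fle FM; split.
  - by left.
  - move=> a b [Fa|[X CX Xa]] ab; first by left; exact: Fle ab.
    have [[_ Xle _] _] := CP _ CX.
    by have [Fb|Xb] := Xle a b (or_intror Xa) ab; [left|right; exists X].
  - have key X a b : C X -> (F `|` X)%classic a -> (F `|` X)%classic b ->
        (F `|` \bigcup_(X in C) X)%classic (a `&` b).
      move=> CX Xa Xb; have [[_ _ XM] _] := CP _ CX.
      by have [Fab|Xab] := XM a b Xa Xb; [left|right; exists X].
    move=> a b [Fa|[X CX Xa]] [Fb|[Y CY Yb]].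
    + by left; exact: FM.
    + by apply: (key Y) => //; [left|right].
    + by apply: (key X) => //; [right|left].
    + have [Z CZ [XZ YZ]] := dir X Y CX CY.
      by apply: (key Z) => //; right; [exact: XZ|exact: YZ].
move=> X [[Xf XI] Xmax]; pose x := (F `|` X)%classic.
have xI a : x a -> ~ I a by move=> [/FI|/XI].
exists x; split=> //; last by move=> a Fa; left.
case: (Xf) => X1 Xle XM.
split=> // [x0|a b xab]; first exact: xI x0 (ideal_bot Ii).
have adj c : ~ x c -> exists2 e, x e & I (e `&` c).
  move=> nxc; apply: contrapT => nI.
  pose Y := [set b | exists2 e, x e & e `&` c <= b].
  have Yf : is_filter Y by exact: is_filter_adjoin.
  have xY : x `<=` Y by move=> e xe; exists e => //; exact: leIl.
  have Yc : Y c by exists \top => //; exact: leIr.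
  apply: (Xmax Y); first split.
  - by move=> e Xe; apply: xY; right.
  - by move=> YX; apply: nxc; right; exact: YX.
  - have YE : (F `|` Y)%classic = Y.
      by apply/seteqP; split=> [e [Fe|//]|e Ye]; [apply: xY; left|right].
    rewrite /P YE; split=> // e [e' xe' e'c] Ie; apply: nI; exists e' => //.
    exact: ideal_le Ii _ _ Ie e'c.
apply: contrapT => /not_orP[/adj[e xe Iea] /adj[e' xe' Ie'b]].
pose g := e `&` e'.
apply: (xI (g `&` (a `|` b))); first exact: XM (XM _ _ xe xe') xab.
apply: ideal_le (heyting_leIU g a b) => //; apply: ideal_join => //.
- by apply: ideal_le Iea _ => //; rewrite leI2// leIl.
- by apply: ideal_le Ie'b _ => //; rewrite leI2// leIr.
Qed.

End PrimeFilterTheorem.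

Record spec d (A : temporalHeytingType d) := PrimeFilter {
  spec_set :> set A;
  spec_prime : is_prime_filter spec_set
}.

HB.instance Definition _ d (A : temporalHeytingType d) := gen_eqMixin (spec A).
HB.instance Definition _ d (A : temporalHeytingType d) :=
  gen_choiceMixin (spec A).

Section SpecOrderTopology.
Context d (A : temporalHeytingType d).
Implicit Types (x y z : spec A) (a b c : A).

Lemma spec_eq x y : (x : set A) = y -> x = y.
Proof.
case: x y => [x xP] [y yP] /= xy; subst y.
by congr PrimeFilter; exact: Prop_irrelevance.
Qed.

(* Order relations are boolean in the library, whence the [asbool]. *)
Definition spec_le x y : bool := `[< (x : set A) `<=` y >].

Lemma spec_le_refl : reflexive spec_le.
Proof. by move=> K; apply/asboolP. Qed.

Lemma spec_le_anti : antisymmetric spec_le.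
Proof.
move=> K L /andP[/asboolP KL /asboolP LK]; apply: spec_eq.
by apply/seteqP; split.
Qed.

Lemma spec_le_trans : transitive spec_le.
Proof.
by move=> L K M /asboolP KL /asboolP LM; apply/asboolP; exact: subset_trans LM.
Qed.

HB.instance Definition _ := Order.Le_isPOrder.Build cat_display (spec A)
  spec_le_refl spec_le_anti spec_le_trans.

Lemma spec_leP x y : reflect ((x : set A) `<=` y) (x <= y).
Proof. exact: asboolP. Qed.

Definition spec_pi a : set (spec A) := [set x | (x : set A) a].

Definition spec_subbase : set (set (spec A)) :=
  [set U | exists a, U = spec_pi a \/ U = (~` spec_pi a)%classic].

HB.instance Definition _ :=
  @isSubBaseTopological.Build (spec A) (set (spec A)) spec_subbase id.

Lemma spec_top x : (x : set A) \top.
Proof. exact: filter_top (prime_filter (spec_prime x)). Qed.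

Lemma spec_bot x : ~ (x : set A) \bot.
Proof. exact: prime_proper (spec_prime x). Qed.

Lemma spec_up x a b : (x : set A) a -> a <= b -> (x : set A) b.
Proof. exact: filter_le (prime_filter (spec_prime x)) _ _. Qed.

Lemma spec_meet x a b :
  (x : set A) (a `&` b) <-> (x : set A) a /\ (x : set A) b.
Proof.
split=> [xab|[]]; last exact: filter_meet (prime_filter (spec_prime x)) _ _.
by split; apply: spec_up xab _; [exact: leIl|exact: leIr].
Qed.

Lemma spec_join x a b :
  (x : set A) (a `|` b) <-> (x : set A) a \/ (x : set A) b.
Proof.
split=> [|[xa|xb]]; first exact: prime_join (spec_prime x) _ _.
- by apply: spec_up xa _; exact: leUl.
- by apply: spec_up xb _; exact: leUr.
Qed.

Lemma open_subbase (U : set (spec A)) : spec_subbase U -> open U.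
Proof.
move=> SU; exists [set U]; last by rewrite bigcup_set1.
move=> _ ->; exists [fset U]%fset.
  by move=> V /fset1P ->; exact: mem_set.
rewrite /= predeqE => x; split=> [|Ux V /fset1P -> //].
by apply; exact: fset11.
Qed.

Lemma clopen_spec_pi a : clopen (spec_pi a).
Proof.
split; first by apply: open_subbase; exists a; left.
by rewrite -openC; apply: open_subbase; exists a; right.
Qed.

Lemma spec_finI x (s : seq (set (spec A))) :
  (forall V, V \in s -> spec_subbase V) -> (forall V, V \in s -> V x) ->
  exists a b, [/\ (x : set A) a, ~ (x : set A) b &
    forall y, (y : set A) a -> ~ (y : set A) b -> forall V, V \in s -> V y].
Proof.
elim: s => [|V s IHs] sS xs.
  by exists \top, \bot; split=> //; [exact: spec_top|exact: spec_bot].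
have [V' V's|V' V's|a [b [xa xb abs]]] := IHs.
- by apply: sS; rewrite inE V's orbT.
- by apply: xs; rewrite inE V's orbT.
have Vx : V x by apply: xs; rewrite inE eqxx.
have [c [Vc|Vc]] := sS V (mem_head _ _); rewrite Vc in Vx.
- exists (a `&` c), b; split=> [|//|y /spec_meet[ya yc] yb V'].
    exact/spec_meet.
  by rewrite inE => /predU1P[->|]; [rewrite Vc|exact: abs].
- exists a, (b `|` c); split=> [//||y ya /spec_join/not_orP[yb yc] V'].
    by move/spec_join=> [].
  by rewrite inE => /predU1P[->|]; [rewrite Vc|exact: abs].
Qed.

Lemma spec_nbhs x (U : set (spec A)) : nbhs x U ->
  exists a b, [/\ (x : set A) a, ~ (x : set A) b &
    forall y, (y : set A) a -> ~ (y : set A) b -> U y].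
Proof.
rewrite nbhsE => -[V [[D DS <-] [W DW Wx]] VU].
have [E ES /= WE] := DS _ DW; move: Wx; rewrite -WE => Wx.
have [V' /ES|V' V's|a [b [xa xb abs]]] := @spec_finI x (enum_fset E).
- by rewrite inE.
- exact: Wx.
exists a, b; split=> // y ya yb; apply: VU; exists W => //.
change ((W : set (spec A)) y); rewrite -WE => V'; exact: abs.
Qed.

Lemma spec_compact : compact [set: spec A].
Proof.
rewrite compact_ultra => F UF _.
pose x := [set a | F (spec_pi a)].
have xP : is_prime_filter x.
  split; first split.
  - by apply: filterS (filterT : F setT) => y _; exact: spec_top.
  - by move=> a b Fa ab; apply: filterS Fa => y ya; exact: spec_up ab.
  - move=> a b Fa Fb; apply: filterS (filterI Fa Fb) => y yab.
    exact/spec_meet.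
  - by move=> /filter_ex[y]; exact: spec_bot.
  - move=> a b Fab; have [|nFa] := in_ultra_setVsetC (spec_pi a) UF.
      by left.
    right; apply: filterS (filterI Fab nFa) => y [/spec_join[]//].
exists (PrimeFilter xP); split=> // U /spec_nbhs[a [b [/= xa xb abU]]].
have [//|nFb] := in_ultra_setVsetC (spec_pi b) UF.
by apply: filterS (filterI xa nFb) => y [ya yb]; exact: abU.
Qed.

End SpecOrderTopology.

Lemma compact_directed (T : topologicalType) (I : Type) (D : set I)
    (f : I -> set T) :
  compact [set: T] -> D !=set0 -> (forall i, D i -> closed (f i)) ->
  (forall i j, D i -> D j ->
     exists2 k, D k & forall t, f k t -> f i t /\ f j t) ->
  (forall i, D i -> f i !=set0) -> \bigcap_(i in D) f i !=set0.
Proof.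
move=> Tc D0 fc fdir f0.
have FF : ProperFilter (filter_from D f).
  by apply: filter_from_proper => //; exact: filter_from_filter.
have [t [_ tF]] := Tc _ FF filterT.
exists t => i Di; apply: fc => // U /tF; apply.
by exists i.
Qed.

Section TemporalHeytingTheory.
Context d (A : temporalHeytingType d).
Implicit Types a b c : A.

Lemma box_mono a b : a <= b -> box a <= box b.
Proof. by move=> /meet_idPl ab; rewrite -ab boxI leIr. Qed.

Lemma le_box_past a : a <= box (past a).
Proof. by rewrite -past_box. Qed.

Lemma past_box_le a : past (box a) <= a.
Proof. by rewrite past_box. Qed.

Lemma past_mono a b : a <= b -> past a <= past b.
Proof. by move=> ab; rewrite past_box (le_trans ab)// le_box_past. Qed.

Lemma past_bot : past \bot = \bot :> A.
Proof. by apply/eqP; rewrite -lex0 past_box le0x. Qed.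

Lemma past_join a b : past (a `|` b) <= past a `|` past b.
Proof.
rewrite past_box leUx; apply/andP; split.
  by rewrite (le_trans (le_box_past a))// box_mono// leUl.
by rewrite (le_trans (le_box_past b))// box_mono// leUr.
Qed.

Lemma himp_mp a b : himp a b `&` a <= b.
Proof. by rewrite le_himp. Qed.

Lemma is_filter_box (x : spec A) : is_filter [set a | (x : set A) (box a)].
Proof.
split=> [|a b xa ab|a b xa xb] /=.
- by apply: spec_up (spec_top x) _; exact: le_box.
- by apply: spec_up xa _; exact: box_mono.
- by rewrite boxI; exact/spec_meet.
Qed.

Lemma is_ideal_past (x : spec A) : is_ideal [set a | ~ (x : set A) (past a)].
Proof.
split=> [|a b xb ab|a b xa xb] /=.
- by rewrite past_bot; exact: spec_bot.
- by move=> xa; apply: xb; apply: spec_up xa _; exact: past_mono.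
- move=> xab; have /spec_join[] : (x : set A) (past a `|` past b) => //.
  exact: spec_up xab (past_join a b).
Qed.

Lemma is_filter_principal a : is_filter [set b | a <= b].
Proof.
split=> [|b c ab bc|b c ab ac] /=.
- exact: lex1.
- exact: le_trans bc.
- by rewrite lexI ab.
Qed.

Lemma is_ideal_principal a : is_ideal [set b | b <= a].
Proof.
split=> [|b c ab bc|b c ab ac] /=.
- exact: le0x.
- exact: le_trans ab.
- by rewrite leUx ab.
Qed.

End TemporalHeytingTheory.

Section SpecEsakia.
Context d (A : temporalHeytingType d).
Implicit Types (x y z : spec A) (a b c : A).

Definition spec_Rfut x : set (spec A) :=
  [set y | forall a, (x : set A) (box a) -> (y : set A) a].

Definition spec_Rpast x : set (spec A) :=
  [set w | forall a, (w : set A) a -> (x : set A) (past a)].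

Lemma spec_himp_ex x a b : ~ (x : set A) (himp a b) ->
  exists y, [/\ x <= y, (y : set A) a & ~ (y : set A) b].
Proof.
move=> nxab.
have [|y [yP Fy Iy]] := prime_filter_theorem
    (is_filter_adjoin a (prime_filter (spec_prime x))) (is_ideal_principal b).
  move=> e [c xc ce] eb; apply: nxab; apply: spec_up xc _.
  by rewrite -le_himp; exact: le_trans eb.
exists (PrimeFilter yP); split=> /=.
- by apply/spec_leP => c xc; apply: Fy; exists c => //; exact: leIl.
- by apply: Fy; exists \top; [exact: spec_top|exact: leIr].
- by move=> /Iy; apply => /=.
Qed.

Lemma spec_box_ex x a : ~ (x : set A) (box a) ->
  exists2 y, spec_Rfut x y & ~ (y : set A) a.
Proof.
move=> nxa.
have [|y [yP Fy Iy]] := prime_filter_theorem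
    (is_filter_box x) (is_ideal_principal a).
  by move=> e xe ea; apply: nxa; apply: spec_up xe _; exact: box_mono.
exists (PrimeFilter yP); first by move=> c xc; exact: Fy.
by move=> /Iy; apply => /=.
Qed.

Lemma spec_past_ex y a : (y : set A) (past a) ->
  exists2 x : spec A, (x : set A) a & spec_Rpast y x.
Proof.
move=> ya.
have [|x [xP Fx Ix]] := prime_filter_theorem
    (is_filter_principal a) (is_ideal_past y).
  by move=> e ae; apply; apply: spec_up ya _; exact: past_mono.
exists (PrimeFilter xP); first by apply: Fx => /=.
by move=> c xc; apply: contrapT; exact: Ix.
Qed.

Lemma spec_Rpast_inv x y : spec_Rpast x y <-> spec_Rfut y x.
Proof.
split=> [xy a ya|yx a ya].
  by apply: spec_up (xy _ ya) _; exact: past_box_le.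
by apply: yx; apply: spec_up ya _; exact: le_box_past.
Qed.

Lemma spec_le_Rfut x y : x <= y <-> spec_Rfut x y \/ x = y.
Proof.
split=> [/spec_leP xy|[xy|->//]]; last first.
  apply/spec_leP => a xa; apply: xy; apply: spec_up xa _; exact: le_box.
have [yx|] := pselect ((y : set A) `<=` x).
  by right; apply: spec_eq; apply/seteqP; split.
move=> /existsNP[b /not_implyP[yb nxb]]; left => a xa.
have /spec_join[//|/xy yba] := spec_up xa (box_le_himp a b).
by apply: spec_up (himp_mp b a); exact/spec_meet.
Qed.

Lemma spec_meets_up x (C : set (spec A)) : closed C ->
  (forall a, (x : set A) a -> exists2 y : spec A, (y : set A) a & C y) ->
  exists2 y, x <= y & C y.
Proof.
move=> Cc xC.
have [||a xa|a b xa xb|a xa|y yI] := @compact_directed (spec A) A x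
    (fun a => (spec_pi a `&` C)%classic).
- exact: spec_compact.
- by exists \top; exact: spec_top.
- by apply: closedI => //; case: (clopen_spec_pi a).
- exists (a `&` b); first exact/spec_meet.
  by move=> t [/spec_meet[ta tb] Ct].
- by have [y ya Cy] := xC a xa; exists y.
exists y; first by apply/spec_leP => a /yI[].
by have [] := yI _ (spec_top x).
Qed.

Lemma clopen_upset_spec_pi (K : set (spec A)) : clopen K -> upset K ->
  exists a, K = spec_pi a.
Proof.
move=> [Ko Kc] Ku; apply: contrapT => nK.
have [||a aK|a b aK bK|a aK|x xI] := @compact_directed (spec A) A
    [set a | spec_pi a `<=` K] (fun a => (K `\` spec_pi a)%classic).
- exact: spec_compact.
- by exists \bot => x /spec_bot.
- rewrite setDE; apply: closedI => //; rewrite closedC.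
  by case: (clopen_spec_pi a).
- exists (a `|` b); first by move=> x /spec_join[/aK|/bK].
  by move=> x [Kx nx]; split; split=> // xa; apply: nx; apply/spec_join;
    [left|right].
- apply: contrapT => nKa; apply: nK; exists a; apply/seteqP; split=> // x Kx.
  by apply: contrapT => nxa; apply: nKa; exists x.
have Kx : K x by have [|] := xI \bot; first by move=> y /spec_bot.
have [|a xa|y xy nKy] := @spec_meets_up x (~` K)%classic.
- by rewrite closedC.
- apply: contrapT => nKa.
  have aK : spec_pi a `<=` K.
    by move=> y ya; apply: contrapT => nKy; apply: nKa; exists y.
  by have [_] := xI a aK; apply.
- exact/nKy/(Ku x).
Qed.

Lemma spec_priestley x y : ~~ (x <= y) ->
  exists U : set (spec A), [/\ clopen U, upset U, U x & ~ U y].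
Proof.
move=> /spec_leP/existsNP[a /not_implyP[xa nya]]; exists (spec_pi a).
by split=> //; [exact: clopen_spec_pi|move=> z w za /spec_leP; exact].
Qed.

Lemma spec_clopen_downset_of (U : set (spec A)) :
  clopen U -> clopen (downset_of U).
Proof.
move=> [Uo Uc]; split.
  rewrite openE => x [y Uy xy].
  have [a [b [ya nyb abU]]] := spec_nbhs (open_nbhs_nbhs (conj Uo Uy)).
  have nx : ~ (x : set A) (himp a b).
    move=> /(spec_leP _ _ xy) yab; apply: nyb.
    by apply: spec_up (himp_mp a b); exact/spec_meet.
  have : nbhs x (~` spec_pi (himp a b))%classic.
    apply: open_nbhs_nbhs; split=> //; rewrite openC.
    by case: (clopen_spec_pi (himp a b)).
  apply: filterS => z /spec_himp_ex[w [zw wa nwb]].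
  by exists w => //; exact: abU.
rewrite -openC openE => x nx.
have [a xa aU] : exists2 a, (x : set A) a & spec_pi a `<=` (~` U)%classic.
  apply: contrapT => na; apply: nx.
  have [a xa|y xy Uy] := spec_meets_up (x := x) Uc; last by exists y.
  apply: contrapT => nya; apply: na; exists a => // y ya Uy.
  by apply: nya; exists y.
have : nbhs x (spec_pi a).
  by apply: open_nbhs_nbhs; split=> //; case: (clopen_spec_pi a).
apply: filterS => z za [y Uy zy]; apply: (aU y) => //.
exact: (spec_leP _ _ zy).
Qed.

HB.instance Definition _ := isEsakia.Build cat_display (spec A)
  (@spec_compact _ A) spec_priestley spec_clopen_downset_of.

Lemma upset_spec_pi a : upset (spec_pi a).
Proof. by move=> x y xa /spec_leP; exact. Qed.

Lemma spec_box_pi a :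
  [set x | spec_Rfut x `<=` spec_pi a] = spec_pi (box a).
Proof.
apply/seteqP; split=> [x xa|x xa y]; last exact.
by apply: contrapT => /spec_box_ex[y /xa].
Qed.

Lemma spec_past_pi a : \bigcup_(x in spec_pi a) spec_Rfut x = spec_pi (past a).
Proof.
apply/seteqP; split=> [y [x xa /spec_Rpast_inv]|y]; first exact.
by move=> /spec_past_ex[x xa /spec_Rpast_inv yx]; exists x.
Qed.

Lemma spec_clopen_upset_box (K : set (spec A)) : clopen K -> upset K ->
  clopen [set x | spec_Rfut x `<=` K] /\ upset [set x | spec_Rfut x `<=` K].
Proof.
move=> Kc /(clopen_upset_spec_pi Kc)[a ->]; rewrite spec_box_pi.
by split; [exact: clopen_spec_pi|exact: upset_spec_pi].
Qed.

Lemma spec_clopen_upset_past (K : set (spec A)) : clopen K -> upset K ->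
  clopen (\bigcup_(x in K) spec_Rfut x) /\
  upset (\bigcup_(x in K) spec_Rfut x).
Proof.
move=> Kc /(clopen_upset_spec_pi Kc)[a ->]; rewrite spec_past_pi.
by split; [exact: clopen_spec_pi|exact: upset_spec_pi].
Qed.

Lemma spec_closed_Rfut x : closed (spec_Rfut x).
Proof.
have -> : spec_Rfut x = \bigcap_(a in [set a | (x : set A) (box a)]) spec_pi a.
  by apply/seteqP; split.
by apply: closed_bigI => a _; case: (clopen_spec_pi a).
Qed.

Lemma spec_closed_Rpast x : closed (spec_Rpast x).
Proof.
have -> : spec_Rpast x =
    \bigcap_(a in [set a | ~ (x : set A) (past a)]) (~` spec_pi a)%classic.
  apply/seteqP; split=> [y xy a nxa /xy//|y xy a ya].
  by apply: contrapT => /xy; apply.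
by apply: closed_bigI => a _; rewrite closedC; case: (clopen_spec_pi a).
Qed.

HB.instance Definition _ := isTemporalEsakia.Build cat_display (spec A)
  spec_le_Rfut spec_Rpast_inv spec_clopen_upset_box spec_clopen_upset_past
  spec_closed_Rfut spec_closed_Rpast.

End SpecEsakia.

Section SpecMorphism.
Context d d' (A : temporalHeytingType d) (B : temporalHeytingType d').
Context (h : tha_hom A B).

Let hP := tha_funP h.

Lemma tha_le a b : a <= b -> h a <= h b.
Proof. by move=> /meet_idPl ab; rewrite -ab (tham_meet hP) leIr. Qed.

Lemma spec_preimage_prime (x : spec B) : is_prime_filter (h @^-1` x).
Proof.
split; first split; rewrite /preimage /=.
- by rewrite (tham_top hP); exact: spec_top.
- by move=> a b xa ab; apply: spec_up xa _; exact: tha_le.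
- by move=> a b xa xb; rewrite (tham_meet hP); exact/spec_meet.
- by rewrite (tham_bot hP); exact: spec_bot.
- by move=> a b; rewrite (tham_join hP) => /spec_join.
Qed.

Definition spec_preimage (x : spec B) : spec A :=
  PrimeFilter (spec_preimage_prime x).

Lemma spec_lift (G : set B) (y : spec A) : is_filter G ->
  (forall a, G (h a) -> (y : set A) a) ->
  exists2 z : spec B, G `<=` z & spec_preimage z = y.
Proof.
move=> [G1 Gle GM] Gy.
pose F := [set b | exists e c, [/\ G e, (y : set A) c & e `&` h c <= b]].
pose I := [set b | exists2 c, ~ (y : set A) c & b <= h c].
have Ff : is_filter F.
  split=> [|b b' [e [c [Ge yc ecb]]] bb'|
            b b' [e [c [Ge yc ecb]]] [e' [c' [Ge' yc' ecb']]]].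
  - by exists \top, \top; split; [|exact: spec_top|exact: lex1].
  - by exists e, c; split=> //; exact: le_trans bb'.
  - exists (e `&` e'), (c `&` c'); split; [exact: GM|exact/spec_meet|].
    rewrite lexI; apply/andP; split.
      by apply: le_trans ecb; rewrite leI2 ?leIl// tha_le// leIl.
    by apply: le_trans ecb'; rewrite leI2 ?leIr// tha_le// leIr.
have Ii : is_ideal I.
  split=> [|b b' [c yc bc] b'b|b b' [c yc bc] [c' yc' bc']].
  - by exists \bot; [exact: spec_bot|exact: le0x].
  - by exists c => //; exact: le_trans bc.
  - exists (c `|` c'); first by move=> /spec_join[].
    by rewrite (tham_join hP) leU2.
have [|z [zP Fz Iz]] := prime_filter_theorem Ff Ii.
  move=> b [e [c [Ge yc ecb]]] [c' nyc' bc']; apply: nyc'.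
  apply: spec_up (himp_mp c c'); apply/spec_meet; split=> //.
  apply: Gy; rewrite (tham_himp hP); apply: Gle Ge _.
  by rewrite -le_himp; exact: le_trans bc'.
exists (PrimeFilter zP) => /=.
  by move=> e Ge; apply: Fz; exists e, \top; split; [|exact: spec_top|exact: leIl].
apply: spec_eq; apply/seteqP; split=> a /=.
  by move=> zha; apply: contrapT => nya; apply: Iz zha _; exists a.
by move=> ya; apply: Fz; exists \top, a; split=> //; exact: leIr.
Qed.

Lemma spec_preimage_continuous : continuous spec_preimage.
Proof.
move=> x U /spec_nbhs[a [b [xa nxb abU]]].
have : nbhs x (spec_pi (h a) `&` ~` spec_pi (h b))%classic.
  apply: open_nbhs_nbhs; split=> //; apply: openI.
    by case: (clopen_spec_pi (h a)).
  by rewrite openC; case: (clopen_spec_pi (h b)).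
by apply: filterS => z [za nzb]; exact: abU.
Qed.

Lemma spec_preimage_fut (x y : spec B) :
  Rfut x y -> Rfut (spec_preimage x) (spec_preimage y).
Proof.
by move=> xy a; rewrite /= /preimage /= (tham_box hP) => /xy.
Qed.

Lemma spec_preimage_morphism : is_tes_morphism spec_preimage.
Proof.
split; first split.
- exact: spec_preimage_continuous.
- by move=> x y /spec_leP xy; apply/spec_leP => a; exact: xy.
- move=> x y /spec_leP xy.
  have [|z xz zy] := spec_lift (y := y) (prime_filter (spec_prime x)).
    by move=> a xa; exact: xy.
  by exists z => //; exact/spec_leP.
- exact: spec_preimage_fut.
- move=> x y xy.
  have [|z xz zy] := spec_lift (y := y) (is_filter_box x); last by exists z.
  move=> a xa; apply: xy.
  by rewrite /= /preimage /= (tham_box hP).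
- by move=> x y /Rpast_inv/spec_preimage_fut/Rpast_inv.
- move=> x y xy.
  have Ff : is_filter [set b | exists2 c, (y : set A) c & h c <= b].
    split=> [|b b' [c yc cb] bb'|b b' [c yc cb] [c' yc' cb']].
    + by exists \top; [exact: spec_top|exact: lex1].
    + by exists c => //; exact: le_trans bb'.
    + exists (c `&` c'); first exact/spec_meet.
      by rewrite (tham_meet hP) leI2.
  have [|z [zP Fz Iz]] := prime_filter_theorem Ff (is_ideal_past x).
    move=> b [c yc cb]; apply; apply: spec_up (past_mono cb).
    by rewrite -(tham_past hP); exact: xy.
  exists (PrimeFilter zP).
    by move=> a za; apply: contrapT; exact: Iz.
  by apply/spec_leP => a ya; apply: Fz; exists a.
Qed.

Definition spec_hom : tes_hom (spec B) (spec A) :=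
  TesHom spec_preimage_morphism.

End SpecMorphism.

Definition Spec : functor tHA (op tES).
Proof.
refine (@Functor tHA (op tES)
  (fun A : tHA => (spec A : temporalEsakiaType cat_display))
  (fun (A B : tHA) (h : tha_hom A B) => spec_hom h) _ _);
  by move=> *; apply: tes_hom_eq => x; exact: spec_eq.
Defined.

(* Main.v *)
From mathcomp Require Import all_boot all_order.
From mathcomp Require Import all_classical.
From mathcomp Require Import topology_structure compact order_topology.
Require Import Defs.

(** The unit sends [a] to the clopen upset [spec_pi a]; it is injective by the
    prime filter theorem and surjective since every clopen upset of a spectrum
    has this form.  The counit sends a point [x] to the prime filter of clopen
    upsets containing it.  It is bijective and bicontinuous by compactness and
    Priestley separation.  It reflects [Rfut] because [Rfut x] is a closed
    upset, hence an intersection of clopen upsets [K], each of which satisfies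
    [x] in [box K]. *)

Set Implicit Arguments.
Unset Strict Implicit.
Unset Printing Implicit Defensive.

Import Order.Theory.

Local Open Scope classical_set_scope.
Local Open Scope order_scope.

(** * Recognising isomorphisms in the two categories *)

Lemma tha_morphism_can d d' (A : temporalHeytingType d)
    (B : temporalHeytingType d') (f : A -> B) (g : B -> A) :
  is_tha_morphism f -> cancel f g -> cancel g f -> is_tha_morphism g.
Proof.
move=> [f1 f2 f3 f4 f5 f6 f7] fK gK.
by split=> *; apply: (can_inj fK); rewrite ?(f1, f2, f3, f4, f5, f6, f7) !gK.
Qed.

(** The order is the reflexive closure of [Rfut] and [Rpast] is its converse, so injectivity carries
    both along with [Rfut]; each back condition is witnessed by [g y]. *)
Lemma tes_morphism_can d d' (X : temporalEsakiaType d)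
    (Y : temporalEsakiaType d') (f : X -> Y) (g : Y -> X) :
  continuous f -> cancel f g -> cancel g f ->
  (forall x y, Rfut x y <-> Rfut (f x) (f y)) -> is_tes_morphism f.
Proof.
move=> fc fK gK fR.
have fle x y : x <= y <-> f x <= f y.
  split=> /le_Rfut xy; apply/le_Rfut.
    by case: xy => [/fR|->]; [left|right].
  by case: xy => [/fR|/(can_inj fK)]; [left|right].
split=> [|x y /fR//|x y|x y /Rpast_inv/fR/Rpast_inv//|x y].
- split=> // [x y /fle//|x y]; rewrite -{1}(gK y) => /fle xy.
  by exists (g y).
- by rewrite -{1}(gK y) => /fR xy; exists (g y).
- rewrite -{1}(gK y) => /Rpast_inv/fR/Rpast_inv xy.
  by exists (g y); rewrite ?gK.
Qed.

(** * Representation of an algebra by clopen upsets of its spectrum *)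

Section Unit.
Context d (A : temporalHeytingType d).
Implicit Types a b : A.

Definition clop_pi a : clop (spec A) :=
  ClopenUpset (clopen_spec_pi a) (@upset_spec_pi _ A a).

(** Lattice operations and bounds only use that points are prime filters. For [himp], [past] and
    [box], one inclusion needs new prime filters, supplied by [spec_himp_ex], [spec_past_pi] and
    [spec_box_pi]. *)
Lemma clop_pi_morphism : is_tha_morphism clop_pi.
Proof.
split=> [a b|a b|a b|a|a||]; apply: clop_eq; apply/seteqP; split=> x //=.
- by move=> /spec_meet.
- by move=> /spec_meet.
- by move=> /spec_join.
- by move=> /spec_join.
- move=> xab [y [ya nyb] /spec_leP xy]; apply: nyb.
  by apply: spec_up (himp_mp a b); apply/spec_meet; split=> //; exact: xy.
- move=> nx; apply: contrapT => /spec_himp_ex[y [xy ya nyb]].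
  by apply: nx; exists y.
- by rewrite -spec_past_pi.
- by move=> xa; rewrite -spec_past_pi.
- by rewrite -spec_box_pi.
- by move=> xa; rewrite -spec_box_pi.
- exact: spec_bot.
- by move=> _; exact: spec_top.
Qed.

Definition clop_pi_hom : tha_hom A (clop (spec A)) := ThaHom clop_pi_morphism.

(** If [a <= b] fails, a prime filter separates the principal filter of [a] from the principal ideal
    of [b]. *)
Lemma spec_pi_le a b : spec_pi a `<=` spec_pi b -> a <= b.
Proof.
move=> ab; apply: contrapT => nab.
have [|x [xP Fx Ix]] :=
    prime_filter_theorem (is_filter_principal a) (is_ideal_principal b).
  by move=> c /= ac cb; apply: nab; exact: le_trans cb.
apply: (Ix b); last exact: lexx.
by apply: (ab (PrimeFilter xP)); apply: Fx => /=.
Qed.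

Lemma clop_pi_inj : injective clop_pi.
Proof.
move=> a b [ab]; apply: le_anti.
by apply/andP; split; apply: spec_pi_le; rewrite ab.
Qed.

Lemma clop_pi_surj (K : clop (spec A)) : exists a, clop_pi a = K.
Proof.
have [a Ka] := clopen_upset_spec_pi (clop_clopen K) (@clop_upset _ _ K).
by exists a; exact: clop_eq.
Qed.

End Unit.

(** * Points of a space as prime filters of clopen upsets *)

Section Counit.
Context d (X : temporalEsakiaType d).
Implicit Types (x y z : X) (K L : clop X).

Lemma point_prime_filter x : is_prime_filter [set K : clop X | (K : set X) x].
Proof. by split=> //; split=> // K L Kx /clop_leP; exact. Qed.

Definition point_filter x : spec (clop X) := PrimeFilter (point_prime_filter x).

Lemma clop_separation x y :
  (forall K, (K : set X) x -> (K : set X) y) -> x <= y.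
Proof.
move=> xy; apply: contrapT => /negP/priestley_separation[U [Uc Uu Ux]].
by apply; exact: (xy (ClopenUpset Uc Uu)).
Qed.

Lemma point_filter_inj : injective point_filter.
Proof.
move=> x y [xy]; apply: le_anti; apply/andP; split; apply: clop_separation => K.
  by rewrite -[_ x]/([set K : clop X | (K : set X) x] K) xy.
by rewrite -[_ y]/([set K : clop X | (K : set X) y] K) -xy.
Qed.

(** Compactness gives a point common to [C] and all [K] minus [L] with [K] in [P] and [L] outside
    [P]. Taking [C] full yields surjectivity; taking the complement of an open set yields a base. *)
Lemma spec_clop_meets (P : spec (clop X)) (C : set X) : closed C ->
  (forall K L, (P : set _) K -> ~ (P : set _) L ->
     (((K : set X) `\` L) `&` C)%classic !=set0) ->
  exists2 x, point_filter x = P & C x.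
Proof.
move=> Cc PC.
have [||[K L] [/= PK PL]|[K L] [K' L'] [/= PK PL] [/= PK' PL']|
      [K L] [/= PK PL]|x xI] := @compact_directed X (clop X * clop X)%type
    [set p | (P : set _) p.1 /\ ~ (P : set _) p.2]
    (fun p => (((p.1 : set X) `\` p.2) `&` C)%classic).
- exact: esakia_compact.
- by exists (\top, \bot); split; [exact: spec_top|exact: spec_bot].
- apply: closedI => //; rewrite setDE; apply: closedI.
    by case: (clop_clopen K).
  by rewrite closedC; case: (clop_clopen L).
(* Primeness of [P] keeps the join outside, which makes the family directed. *)
- exists (K `&` K', L `|` L') => /=.
    by split; [exact/spec_meet|move=> /spec_join[]].
  move=> t [[[Kt K't] /not_orP[Lt L't]] Ct].
  by split.
- exact: PC.
exists x; last first.
  have [|//] := xI (\top, \bot).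
  by split; [exact: spec_top|exact: spec_bot].
apply: spec_eq; apply/seteqP; split=> K /= xK.
  apply: contrapT => nPK; have [|[_ /=]//] := xI (\top, K).
  by split=> //; exact: spec_top.
have [|[//]] := xI (K, \bot).
by split=> //; exact: spec_bot.
Qed.

Lemma point_filter_surj (P : spec (clop X)) : exists x, point_filter x = P.
Proof.
have [|K L PK nPL|x xP _] := @spec_clop_meets P setT; last by exists x.
- exact: closedT.
- rewrite setIT; apply: contrapT => KL; apply: nPL; apply: spec_up PK _.
  by apply/clop_leP => x Kx; apply: contrapT => nLx; apply: KL; exists x.
Qed.

(** Otherwise [spec_clop_meets] finds a point outside the open set [V] with the same filter as [x],
    hence equal to [x]. *)
Lemma clop_nbhs x (U : set X) : nbhs x U ->
  exists K L, [/\ (K : set X) x, ~ (L : set X) x &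
    ((K : set X) `\` L)%classic `<=` U].
Proof.
rewrite nbhsE => -[V [Vo Vx] VU]; apply: contrapT => nKL.
have [|K L Kx nLx|y /point_filter_inj -> /(_ Vx)//] :=
    @spec_clop_meets (point_filter x) (~` V)%classic.
  by rewrite closedC.
apply: contrapT => KLV; apply: nKL; exists K, L; split=> // y KLy.
by apply: VU; apply: contrapT => nVy; apply: KLV; exists y.
Qed.

Lemma upset_Rfut x : upset (Rfut x).
Proof.
move=> y z xy yz; have xley : x <= y by apply/le_Rfut; left.
have /le_Rfut[//|xz] := le_trans xley yz.
(* When [x = z], the chain from [x] through [y] to [z] collapses, so [Rfut x y] is already
   [Rfut x z]. *)
have yx : y = x by apply: le_anti; rewrite xley xz yz.
by move: xy; rewrite yx -xz.
Qed.

(** If no clopen upset missing [y] contains [Rfut x], compactness gives [z] in [Rfut x] outside all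
    of them. Then [z <= y] by separation, and [Rfut x] is an upset. *)
Lemma Rfut_clopP x y :
  Rfut x y <-> forall K, Rfut x `<=` K -> (K : set X) y.
Proof.
split=> [xy K|xKy]; first exact.
have [||K nKy|K L nKy nLy|K nKy|z zI] := @compact_directed X (clop X)
    [set K | ~ (K : set X) y] (fun K => (Rfut x `\` K)%classic).
- exact: esakia_compact.
- by exists \bot => -[].
- rewrite setDE; apply: closedI; first exact: closed_Rfut.
  by rewrite closedC; case: (clop_clopen K).
- exists (K `|` L); first by move=> [].
  by move=> t [xt /not_orP[Kt Lt]].
- apply: contrapT => xK; apply: nKy; apply: xKy => z xz.
  by apply: contrapT => nKz; apply: xK; exists z.
have [|xz _] := zI \bot; first by move=> [].
apply: (upset_Rfut xz); apply: clop_separation => K Kz.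
by apply: contrapT => /zI[_].
Qed.

Lemma point_filter_Rfut x y :
  Rfut x y <-> Rfut (point_filter x) (point_filter y).
(* Membership of [box K] in [point_filter x] unfolds to the inclusion of [Rfut x] in [K]. *)
Proof. exact: Rfut_clopP. Qed.

Lemma point_filter_continuous : continuous point_filter.
Proof.
move=> x U /spec_nbhs[K [L [/= Kx nLx KLU]]].
have : nbhs x (K `&` ~` L)%classic.
  apply: open_nbhs_nbhs; split=> //; apply: openI.
    by case: (clop_clopen K).
  by rewrite openC; case: (clop_clopen L).
by apply: filterS => y [Ky nLy]; exact: KLU.
Qed.

Definition filter_point (P : spec (clop X)) : X :=
  projT1 (cid (point_filter_surj P)).

Lemma filter_pointK : cancel filter_point point_filter.
Proof. by move=> P; exact: projT2 (cid (point_filter_surj P)). Qed.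

Lemma point_filterK : cancel point_filter filter_point.
Proof. by move=> x; apply: point_filter_inj; exact: filter_pointK. Qed.

(** By [clop_nbhs] it suffices to pull back differences of clopen upsets, and [K] contains the point
    of [P] exactly when [P] contains [K]. *)
Lemma filter_point_continuous : continuous filter_point.
Proof.
move=> P U /clop_nbhs[K [L [KP nLP KLU]]].
have PE (M : clop X) : (M : set X) (filter_point P) = (P : set _) M.
  by rewrite -{2}(filter_pointK P).
have : nbhs P (spec_pi K `&` ~` spec_pi L)%classic.
  apply: open_nbhs_nbhs; split; last by move: KP nLP; rewrite !PE.
  apply: openI; first by case: (clopen_spec_pi K).
  by rewrite openC; case: (clopen_spec_pi L).
apply: filterS => Q [QK nQL]; apply: KLU.
by rewrite -(filter_pointK Q) in QK nQL.
Qed.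

Lemma point_filter_morphism : is_tes_morphism point_filter.
Proof.
apply: tes_morphism_can point_filterK filter_pointK point_filter_Rfut.
exact: point_filter_continuous.
Qed.

Lemma filter_point_morphism : is_tes_morphism filter_point.
Proof.
apply: tes_morphism_can filter_pointK point_filterK _.
  exact: filter_point_continuous.
by move=> P Q; rewrite point_filter_Rfut !filter_pointK.
Qed.

Definition point_filter_hom : tes_hom X (spec (clop X)) :=
  TesHom point_filter_morphism.

Definition filter_point_hom : tes_hom (spec (clop X)) X :=
  TesHom filter_point_morphism.

End Counit.

(** * Naturality and the equivalence *)

Lemma filter_point_natural d d' (X : temporalEsakiaType d)
    (Y : temporalEsakiaType d') (f : tes_hom X Y) (P : spec (clop X)) :
  filter_point (spec_hom (clop_hom f) P) = f (filter_point P).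
Proof.
(* This reduces to naturality of [point_filter], where both sides consist of the [K] whose preimage
   under [f] contains the point. *)
apply: point_filter_inj; rewrite filter_pointK -{1}(filter_pointK P).
exact: spec_eq.
Qed.

Lemma Clop_Spec_iso : naturally_isomorphic (idF tHA) (compF Clop Spec).
Proof.
exists (fun A : tHA => clop_pi_hom A); split=> [A B h|A].
  by apply: tha_hom_eq => a; exact: clop_eq.
have [g gK] := choice (@clop_pi_surj _ A).
have Kg : cancel (@clop_pi _ A) g by move=> a; apply: clop_pi_inj.
exists (ThaHom (tha_morphism_can (clop_pi_morphism A) Kg gK)).
by split; apply: tha_hom_eq.
Qed.

(** Arrows are reversed in [op tES], so the component at [X] is [filter_point] and its inverse is
    [point_filter]. *)
Lemma Spec_Clop_iso : naturally_isomorphic (idF (op tES)) (compF Spec Clop).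
Proof.
exists (fun X : tES => filter_point_hom X); split=> [X Y f|X].
  by apply: tes_hom_eq => P; exact: filter_point_natural.
exists (point_filter_hom X).
by split; apply: tes_hom_eq; [exact: point_filterK|exact: filter_pointK].
Qed.

Theorem theorem3p8 :
  pseudo_inverse Spec Clop /\ equivalent_categories tHA (op tES).
Proof.
have SC : pseudo_inverse Spec Clop.
  by split; [exact: Clop_Spec_iso|exact: Spec_Clop_iso].
by split=> //; exists Spec, Clop.
Qed.
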